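(* Let $R$ be a Gorenstein ring. Then the adjunction $Q^0:\operatorname{Ch}(R)\rightleftarrows R\text{-Mod}:\iota^0$ is a Quillen equivalence ${}^{p}\mathcal M^{\mathrm{ctr}}_{\mathrm{sing}}(R)\rightleftarrows\mathcal M^{\mathrm{G\text{-}proj}}(R)$.
   Context: A ring $R$ is Gorenstein if it is Noetherian and of finite injective dimension both as a left and as a right module over itself. $\operatorname{Ch}(R)$ is the category of unbounded ($\mathbb Z$-indexed, cohomologically graded) complexes of $R$-modules. $Q^0(X)=\operatorname{coker}(X^{-1}\to X^0)$ is the $0$-th cosyzygy, and $\iota^0(M)$ is the stalk complex with $M$ in degree $0$; $Q^0$ is left adjoint to $\iota^0$. A model structure on a bicomplete abelian category is abelian if its cofibrations are exactly the monomorphisms with cofibrant cokernel and its fibrations are exactly the epimorphisms with fibrant kernel; it is determined by its classes of cofibrant and fibrant objects. ${}^{p}\mathcal M^{\mathrm{ctr}}_{\mathrm{sing}}(R)$ is the abelian model structure on $\operatorname{Ch}(R)$ in which every object is fibrant and the cofibrant objects are the acyclic complexes with projective components. $\mathcal M^{\mathrm{G\text{-}proj}}(R)$ is Hovey's Gorenstein projective model structure: the abelian model structure on $R\text{-Mod}$ in which every object is fibrant, the cofibrant objects are the Gorenstein projective modules (modules arising as $0$-th syzygy of an acyclic complex of projective $R$-modules), and the weakly trivial objects are the modules of finite projective dimension. *)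

(* Defs.v *)
From HB Require Import structures.
From mathcomp Require Import all_boot all_algebra.
From mathcomp Require Import boolp.

Set Implicit Arguments.
Unset Strict Implicit.
Unset Printing Implicit Defensive.

Import GRing.Theory.
Local Open Scope ring_scope.
Local Open Scope quotient_scope.

Record category := Category {
  Ob :> Type;
  Hom : Ob -> Ob -> Type;
  idm : forall A, Hom A A;
  comp : forall A B C, Hom B C -> Hom A B -> Hom A C;
  comp_idl : forall A B (f : Hom A B), comp (idm B) f = f;
  comp_idr : forall A B (f : Hom A B), comp f (idm A) = f;
  comp_assoc : forall A B C D (h : Hom C D) (g : Hom B C) (f : Hom A B),
    comp h (comp g f) = comp (comp h g) f
}.

Arguments Hom {c} _ _.
Arguments idm {c} A.
Arguments comp {c A B C} _ _.

Notation "g \oc f" := (comp g f) (at level 40, left associativity).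

Record functor (C D : category) := Functor {
  fob :> C -> D;
  fmap : forall A B : C, Hom A B -> Hom (fob A) (fob B);
  fmap_id : forall A : C, fmap (idm A) = idm (fob A);
  fmap_comp : forall (A B E : C) (g : Hom B E) (f : Hom A B),
    fmap (g \oc f) = fmap g \oc fmap f
}.

Arguments fmap {C D} _ {A B} _.

Record adjunction (C D : category) (F : functor C D) (G : functor D C) :=
  Adjunction {
    adj : forall (A : C) (B : D), Hom (F A) B -> Hom A (G B);
    adj_bij : forall A B, bijective (@adj A B);
    adj_nat : forall (A A' : C) (B B' : D)
      (h : Hom A' A) (g : Hom B B') (f : Hom (F A) B),
      adj (g \oc f \oc fmap F h) = fmap G g \oc adj f \oc h
  }.

Arguments adj {C D F G} _ {A B} _.

Section CategoricalNotions.
Variable C : category.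

Definition mono (A B : C) (f : Hom A B) : Prop :=
  forall (X : C) (u v : Hom X A), f \oc u = f \oc v -> u = v.

Definition epi (A B : C) (f : Hom A B) : Prop :=
  forall (X : C) (u v : Hom B X), u \oc f = v \oc f -> u = v.

Definition initial (I : C) : Prop := forall X : C, exists! _ : Hom I X, True.

Definition terminal (T : C) : Prop := forall X : C, exists! _ : Hom X T, True.

Definition zero_object (Z : C) : Prop := initial Z /\ terminal Z.

Definition zero_mor (A B : C) (f : Hom A B) : Prop :=
  exists (Z : C) (p : Hom A Z) (q : Hom Z B), zero_object Z /\ f = q \oc p.

Definition is_kernel (A B : C) (f : Hom A B) (K : C) (k : Hom K A) : Prop :=
  zero_mor (f \oc k) /\
  forall (X : C) (u : Hom X A), zero_mor (f \oc u) ->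
    exists! v : Hom X K, k \oc v = u.

Definition is_cokernel (A B : C) (f : Hom A B) (Q : C) (q : Hom B Q) : Prop :=
  zero_mor (q \oc f) /\
  forall (X : C) (u : Hom B X), zero_mor (u \oc f) ->
    exists! v : Hom Q X, v \oc q = u.

Definition retract_of (A B A' B' : C) (f : Hom A B) (g : Hom A' B') : Prop :=
  exists (i : Hom A A') (r : Hom A' A) (j : Hom B B') (s : Hom B' B),
    [/\ r \oc i = idm A, s \oc j = idm B,
        g \oc i = j \oc f & f \oc r = s \oc g].

(* [i] has the left lifting property with respect to [p]. *)
Definition lifts (A B X Y : C) (i : Hom A B) (p : Hom X Y) : Prop :=
  forall (u : Hom A X) (v : Hom B Y), p \oc u = v \oc i ->
    exists w : Hom B X, w \oc i = u /\ p \oc w = v.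

End CategoricalNotions.

Definition retract_closed (C : category)
    (P : forall A B : C, Hom A B -> Prop) : Prop :=
  forall (A B A' B' : C) (f : Hom A B) (g : Hom A' B'),
    retract_of f g -> P A' B' g -> P A B f.

(* The factorizations are not required to be functorial. *)
Record model_structure (C : category) := ModelStructure {
  weq : forall A B : C, Hom A B -> Prop;
  cof : forall A B : C, Hom A B -> Prop;
  fib : forall A B : C, Hom A B -> Prop;
  weq_comp : forall (A B E : C) (f : Hom A B) (g : Hom B E),
    weq f -> weq g -> weq (g \oc f);
  weq_cancel_l : forall (A B E : C) (f : Hom A B) (g : Hom B E),
    weq g -> weq (g \oc f) -> weq f;
  weq_cancel_r : forall (A B E : C) (f : Hom A B) (g : Hom B E),
    weq f -> weq (g \oc f) -> weq g;
  weq_retract : retract_closed weq;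
  cof_retract : retract_closed cof;
  fib_retract : retract_closed fib;
  lift_cof_tfib : forall (A B X Y : C) (i : Hom A B) (p : Hom X Y),
    cof i -> fib p -> weq p -> lifts i p;
  lift_tcof_fib : forall (A B X Y : C) (i : Hom A B) (p : Hom X Y),
    cof i -> weq i -> fib p -> lifts i p;
  fact_cof_tfib : forall (A B : C) (f : Hom A B),
    exists (E : C) (i : Hom A E) (p : Hom E B),
      [/\ f = p \oc i, cof i, fib p & weq p];
  fact_tcof_fib : forall (A B : C) (f : Hom A B),
    exists (E : C) (i : Hom A E) (p : Hom E B),
      [/\ f = p \oc i, cof i, weq i & fib p]
}.

Arguments weq {C} _ {A B} _.
Arguments cof {C} _ {A B} _.
Arguments fib {C} _ {A B} _.

Section ModelNotions.
Variables (C : category) (M : model_structure C).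

Definition cofibrant (X : C) : Prop :=
  exists (I : C) (f : Hom I X), initial I /\ cof M f.

Definition fibrant (X : C) : Prop :=
  exists (T : C) (f : Hom X T), terminal T /\ fib M f.

Definition weakly_trivial (X : C) : Prop :=
  exists (I : C) (f : Hom I X), initial I /\ weq M f.

Definition abelian_model : Prop :=
  (forall (A B : C) (f : Hom A B), cof M f <->
     mono f /\ exists (Q : C) (q : Hom B Q), is_cokernel f q /\ cofibrant Q) /\
  (forall (A B : C) (f : Hom A B), fib M f <->
     epi f /\ exists (K : C) (k : Hom K A), is_kernel f k /\ fibrant K).

End ModelNotions.

Section Quillen.
Variables (C D : category) (F : functor C D) (G : functor D C).
Variables (a : adjunction F G) (MC : model_structure C) (MD : model_structure D).

Definition quillen_adjunction : Prop :=
  (forall (A B : C) (f : Hom A B), cof MC f -> cof MD (fmap F f)) /\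
  (forall (A B : C) (f : Hom A B),
     cof MC f -> weq MC f -> cof MD (fmap F f) /\ weq MD (fmap F f)).

(* Between a cofibrant and a fibrant object, a map out of [F X] is a weak
   equivalence iff its transpose along the given adjunction is one. *)
Definition quillen_equivalence : Prop :=
  quillen_adjunction /\
  forall (X : C) (Y : D), cofibrant MC X -> fibrant MD Y ->
    forall f : Hom (F X) Y, weq MD f <-> weq MC (adj a f).

End Quillen.

Lemma linear_ext (R : pzRingType) (U V : lmodType R) (f g : {linear U -> V}) :
  f =1 g -> f = g.
Proof.
case: f g => [f [[af] [sf]]] [g [[ag] [sg]]] /= /funext fg; subst g.
by rewrite (Prop_irrelevance af ag) (Prop_irrelevance sf sg).
Qed.

Section Modules.
Variable R : pzRingType.

(* The choice structure carried by an [lmodType] exists on any type by the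
   axioms of boolp, so it does not restrict the modules considered. *)
Definition LMod : category.
Proof.
refine (@Category (lmodType R) (fun U V => {linear U -> V})
  (fun U => idfun) (fun U V W g f => g \o f) _ _ _);
  by intros; apply: linear_ext.
Defined.

Definition injective_module (E : lmodType R) : Prop :=
  forall (A B : lmodType R) (i : {linear A -> B}) (f : {linear A -> E}),
    injective i -> exists g : {linear B -> E}, forall a, g (i a) = f a.

Definition projective_module (P : lmodType R) : Prop :=
  forall (A B : lmodType R) (p : {linear A -> B}) (f : {linear P -> B}),
    (forall b, exists a, p a = b) ->
    exists g : {linear P -> A}, forall x, p (g x) = f x.

Definition zero_module (M : lmodType R) : Prop := forall x : M, x = 0.

Definition exact_at (U V W : lmodType R)
    (f : {linear U -> V}) (g : {linear V -> W}) : Prop :=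
  forall v, g v = 0 <-> exists u, f u = v.

(* An exact sequence 0 -> M -> I 0 -> I 1 -> ... -> I n -> 0 with injective
   terms, padded by zero modules. *)
Definition finite_injdim (M : lmodType R) : Prop :=
  exists (n : nat) (I : nat -> lmodType R)
         (e : {linear M -> I 0%N}) (d : forall k, {linear I k -> I k.+1}),
    [/\ forall k, injective_module (I k),
        forall k, (n < k)%N -> zero_module (I k),
        injective e,
        exact_at e (d 0%N)
      & forall k, exact_at (d k) (d k.+1)].

(* An exact sequence 0 -> P n -> ... -> P 1 -> P 0 -> M -> 0 with projective
   terms, padded by zero modules. *)
Definition finite_projdim (M : lmodType R) : Prop :=
  exists (n : nat) (P : nat -> lmodType R)
         (e : {linear P 0%N -> M}) (d : forall k, {linear P k.+1 -> P k}),
    [/\ forall k, projective_module (P k),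
        forall k, (n < k)%N -> zero_module (P k),
        forall m, exists x, e x = m,
        exact_at (d 0%N) e
      & forall k, exact_at (d k.+1) (d k)].

Definition is_submodule (M : lmodType R) (S : M -> Prop) : Prop :=
  S 0 /\ forall (a : R) x y, S x -> S y -> S (a *: x + y).

Definition noetherian_module (M : lmodType R) : Prop :=
  forall S : nat -> M -> Prop,
    (forall n, is_submodule (S n)) ->
    (forall n x, S n x -> S n.+1 x) ->
    exists N, forall n x, (N <= n)%N -> S n x -> S N x.

End Modules.

(* Right R-modules are left modules over the converse ring R^c; in particular
   R^c^o is R as a right module over itself, with a *: x = x * a in R. *)
Definition gorenstein (R : pzRingType) : Prop :=
  [/\ noetherian_module (R^o : lmodType R),
      noetherian_module (R^c^o : lmodType R^c),
      finite_injdim (R^o : lmodType R)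
    & finite_injdim (R^c^o : lmodType R^c)].

Section Complexes.
Variable R : pzRingType.

(* Cohomological grading.  To avoid casts along equations between degrees there
   is a map [diff i j] for all [i] and [j]; only those with [j = i + 1] carry
   data, the others being zero. *)
Record complex := Complex {
  cob :> int -> lmodType R;
  diff : forall i j, {linear cob i -> cob j};
  diff_shape : forall i j x, j != i + 1 -> diff i j x = 0;
  diff_diff : forall i j k x, diff j k (diff i j x) = 0
}.

Arguments diff : clear implicits.

Record chain_map (X Y : complex) := ChainMap {
  cmap :> forall i, {linear X i -> Y i};
  cmap_diff : forall i j x, cmap j (diff X i j x) = diff Y i j (cmap i x)
}.

Lemma chain_map_ext (X Y : complex) (f g : chain_map X Y) :
  (forall i, f i =1 g i) -> f = g.
Proof.
case: f g => [f cf] [g cg] /= fg.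
have {fg}e : f = g by apply: functional_extensionality_dep => i; exact/linear_ext/fg.
by subst g; congr ChainMap; apply: Prop_irrelevance.
Qed.

Lemma chain_id_diff (X : complex) i j x :
  (idfun : {linear X j -> X j}) (diff X i j x) =
  diff X i j ((idfun : {linear X i -> X i}) x).
Proof. by []. Qed.

Definition chain_id (X : complex) : chain_map X X :=
  ChainMap (@chain_id_diff X).

Lemma chain_comp_diff (X Y Z : complex) (g : chain_map Y Z) (f : chain_map X Y)
    i j x :
  (g j \o f j : {linear X j -> Z j}) (diff X i j x) =
  diff Z i j ((g i \o f i : {linear X i -> Z i}) x).
Proof. by rewrite /= !cmap_diff. Qed.

Definition chain_comp (X Y Z : complex) (g : chain_map Y Z) (f : chain_map X Y) :
    chain_map X Z :=
  ChainMap (chain_comp_diff g f).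

Definition Ch : category.
Proof.
refine (@Category complex chain_map chain_id chain_comp _ _ _);
  by intros; apply: chain_map_ext.
Defined.

Definition acyclic (X : complex) : Prop :=
  forall i : int, exact_at (diff X (i - 1) i) (diff X i (i + 1)).

Definition acyclic_projective (X : complex) : Prop :=
  acyclic X /\ forall i, projective_module (X i).

(* [k] exhibits [M] as the 0-th syzygy Z^0(X) = ker(X^0 -> X^1). *)
Definition gorenstein_projective (M : lmodType R) : Prop :=
  exists2 X : complex, acyclic_projective X &
    exists k : {linear M -> X 0}, injective k /\ exact_at k (diff X 0 1).

End Complexes.

Arguments diff {R} _ _ _.

Section Cokernel.
Variables (R : pzRingType) (U V : lmodType R) (f : {linear U -> V}).

Definition range_pred : {pred V} := fun v => `[< exists u, f u = v >].

Lemma range_submod_closed : submod_closed range_pred.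
Proof.
split=> [|a _ _ /asboolP[u <-] /asboolP[v <-]]; apply/asboolP.
  by exists 0; rewrite linear0.
by exists (a *: u + v); rewrite linearP.
Qed.

HB.instance Definition _ :=
  GRing.isSubmodClosed.Build R V range_pred range_submod_closed.

Definition coker : Type := Quotient.quot range_pred.

HB.instance Definition _ := Choice.on coker.
HB.instance Definition _ := GRing.Zmodule.on coker.

Definition coker_pi (v : V) : coker := \pi_(Quotient.quot range_pred) v.
Definition coker_repr (q : coker) : V := repr (q : Quotient.quot range_pred).

Lemma coker_reprK q : coker_pi (coker_repr q) = q.
Proof. exact: reprK. Qed.

Lemma coker_piP v w : coker_pi v = coker_pi w <-> exists u, f u = v - w.
Proof.
split=> [/eqP|h]; rewrite /coker_pi.
  by rewrite -Quotient.idealrBE => /asboolP.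
by apply/eqP; rewrite -Quotient.idealrBE; apply/asboolP.
Qed.

Lemma coker_piB : {morph coker_pi : v w / v - w}.
Proof. by move=> v w; rewrite /coker_pi raddfB. Qed.

Lemma coker_piD : {morph coker_pi : v w / v + w}.
Proof. by move=> v w; rewrite /coker_pi raddfD. Qed.

Definition coker_scale (a : R) (q : coker) : coker :=
  coker_pi (a *: coker_repr q).

Lemma coker_scaleE a v : coker_scale a (coker_pi v) = coker_pi (a *: v).
Proof.
apply/coker_piP; have /coker_piP[u fu] := coker_reprK (coker_pi v).
by exists (a *: u); rewrite linearZ /= fu scalerBr.
Qed.

Lemma coker_scaleA a b q :
  coker_scale a (coker_scale b q) = coker_scale (a * b) q.
Proof. by rewrite -(coker_reprK q) !coker_scaleE scalerA. Qed.

Lemma coker_scale1 : left_id 1 coker_scale.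
Proof. by move=> q; rewrite -(coker_reprK q) coker_scaleE scale1r. Qed.

Lemma coker_scaleDr : right_distributive coker_scale +%R.
Proof.
move=> a q r; rewrite -(coker_reprK q) -(coker_reprK r) -coker_piD.
by rewrite !coker_scaleE scalerDr coker_piD.
Qed.

Lemma coker_scaleDl q : {morph coker_scale^~ q : a b / a + b}.
Proof.
by move=> a b; rewrite -(coker_reprK q) !coker_scaleE scalerDl coker_piD.
Qed.

HB.instance Definition _ := GRing.Zmodule_isLmodule.Build R coker
  coker_scaleA coker_scale1 coker_scaleDr coker_scaleDl.

Lemma coker_pi_linear : linear coker_pi.
Proof. by move=> a v w; rewrite coker_piD -coker_scaleE. Qed.

HB.instance Definition _ :=
  GRing.isLinear.Build R V coker *:%R coker_pi coker_pi_linear.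

Lemma coker_pi0 u : coker_pi (f u) = 0.
Proof. by rewrite -(linear0 coker_pi); apply/coker_piP; exists u; rewrite subr0. Qed.

Section Lift.
Variables (W : lmodType R) (h : {linear V -> W}) (hf : forall u, h (f u) = 0).

Definition coker_lift_fun (q : coker) : W := h (coker_repr q).

Lemma coker_lift_funE v : coker_lift_fun (coker_pi v) = h v.
Proof.
have /coker_piP[u fu] := coker_reprK (coker_pi v).
by apply/eqP; rewrite -subr_eq0 -linearB -fu hf.
Qed.

Lemma coker_lift_linear : linear coker_lift_fun.
Proof.
move=> a q r; rewrite -(coker_reprK q) -(coker_reprK r) -linearP.
by rewrite !coker_lift_funE linearP.
Qed.

HB.instance Definition _ :=
  GRing.isLinear.Build R coker W *:%R coker_lift_fun coker_lift_linear.

Definition coker_lift : {linear coker -> W} := coker_lift_fun.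

Lemma coker_liftE v : coker_lift (coker_pi v) = h v.
Proof. exact: coker_lift_funE. Qed.

End Lift.

Lemma coker_ext (W : lmodType R) (g h : {linear coker -> W}) :
  (forall v, g (coker_pi v) = h (coker_pi v)) -> g = h.
Proof. by move=> gh; apply: linear_ext => q; rewrite -(coker_reprK q). Qed.

End Cokernel.

Section CosyzygyStalk.
Variable R : pzRingType.

Definition Q0_ob (X : complex R) : lmodType R := coker (diff X (-1) 0).

Definition Q0_pi (X : complex R) : {linear X 0 -> Q0_ob X} :=
  @coker_pi R _ _ (diff X (-1) 0).

Lemma Q0_map_subproof (X Y : complex R) (f : chain_map X Y) x :
  (Q0_pi Y \o f 0 : {linear X 0 -> Q0_ob Y}) (diff X (-1) 0 x) = 0.
Proof. by rewrite /= cmap_diff; apply: coker_pi0. Qed.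

Definition Q0_map (X Y : complex R) (f : chain_map X Y) :
    {linear Q0_ob X -> Q0_ob Y} :=
  coker_lift (Q0_map_subproof f).

Lemma Q0_mapE (X Y : complex R) (f : chain_map X Y) x :
  Q0_map f (Q0_pi X x) = Q0_pi Y (f 0 x).
Proof. exact: coker_liftE. Qed.

Definition Q0 : functor (Ch R) (LMod R).
Proof.
refine (@Functor (Ch R) (LMod R) Q0_ob Q0_map _ _).
- by move=> X; apply: coker_ext => x; rewrite Q0_mapE.
- move=> X Y Z g f; apply: coker_ext => x.
  change (Q0_map (chain_comp g f) (Q0_pi X x) =
          Q0_map g (Q0_map f (Q0_pi X x))).
  by rewrite !Q0_mapE.
Defined.

(* 'rV[R]_0 is the zero module. *)
Definition stalk_ob (M : lmodType R) (i : int) : lmodType R :=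
  if i is Posz 0 then M else 'rV[R]_0.

Definition stalk (M : lmodType R) : complex R.
Proof.
by refine (@Complex R (stalk_ob M) (fun i j => \0) _ _).
Defined.

Definition stalk_map_ob (M N : lmodType R) (f : {linear M -> N}) (i : int) :
    {linear stalk_ob M i -> stalk_ob N i} :=
  match i return {linear stalk_ob M i -> stalk_ob N i} with
  | Posz 0 => f
  | _ => idfun
  end.

Definition stalk_map (M N : lmodType R) (f : {linear M -> N}) :
  chain_map (stalk M) (stalk N).
Proof.
refine (@ChainMap R (stalk M) (stalk N) (stalk_map_ob f) _).
by move=> i j x /=; rewrite linear0.
Defined.

Definition iota0 : functor (LMod R) (Ch R).
Proof.
refine (@Functor (LMod R) (Ch R) stalk stalk_map _ _).
- by move=> M; apply: chain_map_ext => -[[|i]|i] x.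
- by move=> M N P g f; apply: chain_map_ext => -[[|i]|i] x.
Defined.

Section Transpose.
Variables (X : complex R) (M : lmodType R).

Definition transpose_ob (f : {linear Q0_ob X -> M}) (i : int) :
    {linear X i -> stalk_ob M i} :=
  match i return {linear X i -> stalk_ob M i} with
  | Posz 0 => f \o Q0_pi X
  | _ => \0
  end.

Definition transpose (f : {linear Q0_ob X -> M}) : chain_map X (stalk M).
Proof.
refine (@ChainMap R X (stalk M) (transpose_ob f) _).
move=> i [[|j]|j] x //=.
have [ei|ni] := eqVneq i (-1); last first.
  by rewrite diff_shape ?linear0 // eq_sym addr_eq0.
by subst i; rewrite /Q0_pi coker_pi0 linear0.
Defined.

Lemma untranspose_subproof (g : chain_map X (stalk M)) x :
  (g 0 : {linear X 0 -> M}) (diff X (-1) 0 x) = 0.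
Proof. by rewrite (cmap_diff g). Qed.

Definition untranspose (g : chain_map X (stalk M)) : {linear Q0_ob X -> M} :=
  coker_lift (untranspose_subproof g).

Lemma transposeK : cancel transpose untranspose.
Proof. by move=> f; apply: coker_ext => x; rewrite coker_liftE. Qed.

Lemma untransposeK : cancel untranspose transpose.
Proof.
move=> g; apply: chain_map_ext => -[[|i]|i] x; last 2 first.
- by apply/rowP => -[].
- by apply/rowP => -[].
exact: (coker_liftE (untranspose_subproof g)).
Qed.

End Transpose.

Definition Q0_iota0_adjunction : adjunction Q0 iota0.
Proof.
refine (@Adjunction (Ch R) (LMod R) Q0 iota0 transpose _ _).
- by move=> X M; exists (@untranspose X M);
    [exact: transposeK | exact: untransposeK].
- move=> X X' M M' h g f; apply: chain_map_ext => -[[|i]|i] x //=.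
  change (g (f (Q0_map h (Q0_pi X' x))) = g (f (Q0_pi X (h 0 x)))).
  by rewrite Q0_mapE.
Defined.

End CosyzygyStalk.

Definition ctr_sing_model (R : pzRingType) (M : model_structure (Ch R)) : Prop :=
  [/\ abelian_model M,
      forall X : Ch R, fibrant M X
    & forall X : Ch R, cofibrant M X <-> acyclic_projective X].

Definition Gproj_model (R : pzRingType) (M : model_structure (LMod R)) : Prop :=
  [/\ abelian_model M,
      forall A : LMod R, fibrant M A,
      forall A : LMod R, cofibrant M A <-> gorenstein_projective A
    & forall A : LMod R, weakly_trivial M A <-> finite_projdim A].

(* Main.v *)
From HB Require Import structures.
From mathcomp Require Import all_boot all_algebra.
From mathcomp Require Import boolp.
Require Import Defs.

(** In both structures every object is fibrant and every degreewise surjective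
    map is a fibration.

    [Q0] is left Quillen.  A cofibration of complexes is a degreewise
    monomorphism with acyclic, degreewise projective cokernel [C].  Acyclicity
    of [C] keeps [Q0] of it injective ([Q0_cof]), and the cokernel becomes
    [Q0 C], which embeds in [C 1] as a syzygy of [C] and so is Gorenstein
    projective.  Trivial cofibrations are characterized by lifting against
    fibrations; since [iota0] turns fibrations, i.e. epimorphisms, into
    fibrations, adjunction does the rest ([Q0_iota0_quillen]).

    For the equivalence, the transpose of [f : Q0 X -> Y] is the composite
    of the unit [X -> iota0 (Q0 X)] and [iota0 f].  By two-out-of-three it is
    enough that the unit is a weak equivalence for cofibrant [X] and that
    [iota0] both preserves and reflects weak equivalences.

    - The unit ([unit_weq]) is shown to be a trivial fibration: a lift
      against a cofibration with cokernel [C] is built degree by degree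
      ([unit_lift]).  In degree 0 and below, each step lifts along a map of
      [X], which is possible because [C] is projective and [X] is acyclic.  In
      positive degrees, each step extends a map into a projective [X k] along a
      monomorphism whose cokernel is a Gorenstein projective cosyzygy of [C].
      Such extensions exist because a projective module has finite projective
      dimension, so it is weakly trivial in the Gorenstein projective structure
      ([Gproj_extend]): this is the vanishing of Ext^1(G, P).

    - [iota0] preserves weak equivalences because it is right Quillen and all
      modules are fibrant ([iota0_weq], Ken Brown's argument).

    - [iota0] reflects them ([iota0_reflects_weq]) because every cofibration
      [j : X -> Y] of modules arises from a cofibration of complexes out of
      [iota0 X]: pull [iota0 Y] back along a resolution [D -> iota0 (coker j)]
      by an acyclic complex of projectives ([stalk_cofibration]).  Hence an
      epimorphism [p] with [iota0 p] a trivial fibration lifts against all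
      cofibrations of modules. *)

Set Implicit Arguments.
Unset Strict Implicit.
Unset Printing Implicit Defensive.

Import GRing.Theory.
Local Open Scope ring_scope.

Lemma family_choice I (T : I -> Type) (P : forall i, T i -> Prop) :
  (forall i, exists x, P i x) -> exists f : forall i, T i, forall i, P i (f i).
Proof. by move=> h; exists (fun i => projT1 (cid (h i))) => i; case: cid. Qed.

(** * Modules *)

Section Kernel.
Variables (R : pzRingType) (U V : lmodType R) (f : {linear U -> V}).

Definition ker_pred : {pred U} := fun x => f x == 0.

Lemma ker_submod_closed : submod_closed ker_pred.
Proof.
split=> [|a x y /eqP fx /eqP fy]; rewrite unfold_in /ker_pred.
  by rewrite linear0.
by rewrite linearP fx fy scaler0 addr0.
Qed.

HB.instance Definition _ :=
  GRing.isSubmodClosed.Build R U ker_pred ker_submod_closed.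

Record ker : Type := Ker { ker_val : U; _ : ker_val \in ker_pred }.

HB.instance Definition _ := [isSub for ker_val].
HB.instance Definition _ := [Choice of ker by <:].
HB.instance Definition _ := [SubChoice_isSubLmodule of ker by <:].

Definition ker_incl : {linear ker -> U} := \val.

Lemma ker_incl_inj : injective ker_incl.
Proof. exact: val_inj. Qed.

Lemma ker_exact : exact_at ker_incl f.
Proof.
move=> x; split=> [/eqP fx|[y <-]]; first by exists (Ker fx).
exact: (eqP (valP y)).
Qed.

End Kernel.

Section Cokernel.
Variables (R : pzRingType) (U V : lmodType R) (f : {linear U -> V}).

Definition coker_map : {linear V -> coker f} := @coker_pi R U V f.

Lemma coker_surj q : exists v, coker_map v = q.
Proof. by exists (coker_repr q); apply: coker_reprK. Qed.

Lemma coker_exact : exact_at f coker_map.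
Proof.
move=> v; split=> [pv|[u <-]]; last exact: coker_pi0.
have [|u fu] := (coker_piP f v 0).1; last by exists u; rewrite fu subr0.
exact: etrans pv (esym (linear0 coker_map)).
Qed.

End Cokernel.

Arguments coker_surj {R U V} f q.

Section LinearMaps.
Variable R : pzRingType.
Implicit Types A B C G P S U V W X Y : lmodType R.

(** Linear maps are produced below by naming their graph, so that linearity
    never depends on how preimages are chosen. *)
Lemma linear_graph U V (r : U -> V -> Prop) :
  (forall x, exists y, r x y) ->
  (forall x y y', r x y -> r x y' -> y = y') ->
  (forall a x x' y y', r x y -> r x' y' -> r (a *: x + x') (a *: y + y')) ->
  exists g : {linear U -> V}, forall x, r x (g x).
Proof.
move=> /choice[g rg] r_inj r_lin.
have g_lin : linear g by move=> a x y; apply: r_inj (rg _) (r_lin _ _ _ _ _ _ _).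
pose G : {linear U -> V} := HB.pack g (GRing.isLinear.Build R U V *:%R g g_lin).
by exists G.
Qed.

Lemma factor_surj A C X (q : {linear A -> C}) (u : {linear A -> X}) :
  (forall c, exists a, q a = c) -> (forall a, q a = 0 -> u a = 0) ->
  exists v : {linear C -> X}, forall a, v (q a) = u a.
Proof.
move=> q_surj qu.
have [|||v rv] := @linear_graph C X (fun c x => exists2 a, q a = c & u a = x).
- by move=> c; have [a qa] := q_surj c; exists (u a); exists a.
- move=> _ _ _ [a <- <-] [b qb <-]; apply/eqP; rewrite -subr_eq0 -linearB.
  by apply/eqP/qu; rewrite linearB qb subrr.
- by move=> k _ _ _ _ [a <- <-] [b <- <-]; exists (k *: a + b); rewrite linearP.
exists v => a; have [b qb <-] := rv (q a); apply/eqP.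
by rewrite -subr_eq0 -linearB; apply/eqP/qu; rewrite linearB qb subrr.
Qed.

Lemma factor_inj A C X (k : {linear A -> C}) (u : {linear X -> C}) :
  injective k -> (forall x, exists a, k a = u x) ->
  exists v : {linear X -> A}, forall x, k (v x) = u x.
Proof.
move=> k_inj ku.
have [//|||v rv] := @linear_graph X A (fun x a => k a = u x); last by exists v.
- by move=> x a b ka kb; apply: k_inj; rewrite ka.
- by move=> c x y a b ka kb; rewrite !linearP ka kb.
Qed.

Definition pb_map A B C (f : {linear A -> C}) (g : {linear B -> C})
  : {linear (A * B)%type -> C} := (f \o fst) \- (g \o snd).

Definition pb A B C (f : {linear A -> C}) (g : {linear B -> C}) : lmodType R :=
  ker (pb_map f g).

Definition pb_fst A B C (f : {linear A -> C}) (g : {linear B -> C})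
  : {linear pb f g -> A} := fst \o ker_incl (pb_map f g).

Definition pb_snd A B C (f : {linear A -> C}) (g : {linear B -> C})
  : {linear pb f g -> B} := snd \o ker_incl (pb_map f g).

Section Pullback.
Variables (A B C : lmodType R) (f : {linear A -> C}) (g : {linear B -> C}).

Lemma pb_inj (v w : pb f g) :
  pb_fst f g v = pb_fst f g w -> pb_snd f g v = pb_snd f g w -> v = w.
Proof.
move=> e1 e2; apply: (@ker_incl_inj _ _ _ (pb_map f g)).
by apply/pair_eqP/andP; split; apply/eqP.
Qed.

Lemma pb_square (v : pb f g) : f (pb_fst f g v) = g (pb_snd f g v).
Proof.
apply/eqP; rewrite -subr_eq0; apply/eqP.
by apply/(ker_exact (pb_map f g)); exists v.
Qed.

Lemma pb_mk a b : f a = g b ->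
  exists2 v : pb f g, pb_fst f g v = a & pb_snd f g v = b.
Proof.
move=> fg; have /(ker_exact (pb_map f g))[v ev] : pb_map f g (a, b) = 0.
  by rewrite /= fg subrr.
by exists v; [exact: (congr1 fst ev) | exact: (congr1 snd ev)].
Qed.

Lemma pb_lift X (a : {linear X -> A}) (b : {linear X -> B}) :
  (forall x, f (a x) = g (b x)) ->
  exists s : {linear X -> pb f g}, forall x,
    pb_fst f g (s x) = a x /\ pb_snd f g (s x) = b x.
Proof.
move=> fg; apply: (@linear_graph _ _ (fun x v =>
  pb_fst f g v = a x /\ pb_snd f g v = b x)) => [x|x v w|c x x' v v'].
- by have [v va vb] := pb_mk (fg x); exists v.
- by move=> [e1 e2] [e1' e2']; apply: pb_inj; rewrite ?e1 ?e2 ?e1' ?e2'.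
- by move=> [e1 e2] [e1' e2']; rewrite !linearP e1 e2 e1' e2'.
Qed.

End Pullback.

(** Pull [p] back along [f]: as [p] covers the image of [f], the projection of
    the pullback onto [P] is surjective, and any splitting of it yields [g]. *)
Lemma projective_lift P X Y (p : {linear X -> Y}) (f : {linear P -> Y}) :
  projective_module P -> (forall c, exists x, p x = f c) ->
  exists g : {linear P -> X}, forall c, p (g c) = f c.
Proof.
move=> projP pf.
have [|s sK] := projP _ _ (pb_snd p f) idfun.
  by move=> c; have [x /pb_mk[v _ <-]] := pf c; exists v.
by exists (pb_fst p f \o s) => c; rewrite /= (pb_square (s c)) sK.
Qed.

(** A projective cokernel splits [i], so [B] is [A + C] and the lift is [u] on
    [A] together with any lift on [C]. *)
Lemma lift_projective_coker A B C X Y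
    (i : {linear A -> B}) (q : {linear B -> C})
    (p : {linear X -> Y}) (u : {linear A -> X}) (v : {linear B -> Y}) :
  injective i -> (forall c, exists b, q b = c) -> exact_at i q ->
  projective_module C ->
  (forall b, exists x, p x = v b) -> (forall a, p (u a) = v (i a)) ->
  exists2 w : {linear B -> X},
    forall a, w (i a) = u a & forall b, p (w b) = v b.
Proof.
move=> i_inj q_surj iq projC pv puv.
have [s sK] := projC _ _ q idfun q_surj.
have [|r rE] := @factor_inj A B B i (idfun \- (s \o q)) i_inj.
  by move=> b; apply/iq; rewrite /= linearB sK subrr.
have [|t tE] := @projective_lift C X Y p (v \o s) projC; first by move=> c; apply: pv.
exists ((u \o r) \+ (t \o q)) => [a|b] /=.
  have qi : q (i a) = 0 by apply/iq; exists a.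
  have -> : r (i a) = a by apply: i_inj; rewrite rE /= qi linear0 subr0.
  by rewrite qi linear0 addr0.
by rewrite linearD puv rE tE /= linearB subrK.
Qed.

Lemma zero_module_rV0 : zero_module ('rV[R]_0 : lmodType R).
Proof. by move=> x; apply/rowP => -[]. Qed.

Lemma finite_projdim_projective P : projective_module P -> finite_projdim P.
Proof.
move=> projP.
exists 0%N, (fun k => if k is 0%N then P else 'rV[R]_0 : lmodType R), idfun,
  (fun k => \0); split=> [[|k]|[|k] //|x|x|k x] //=.
- by move=> A B p f _; exists \0 => x; rewrite (zero_module_rV0 x) !linear0.
- by move=> _; apply: zero_module_rV0.
- by exists x.
- by split=> [->|[_ <-]]; first by exists 0.
- by split=> // _; exists 0; rewrite (zero_module_rV0 x).
Qed.

End LinearMaps.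

(** * Model categories *)

Lemma terminal_uniq (C : category) (T A : C) (u v : Hom A T) :
  terminal T -> u = v.
Proof. by move=> termT; have [w [_ uw]] := termT A; rewrite -(uw u I) -(uw v I). Qed.

Section ModelCategory.
Variables (C : category) (M : model_structure C).

(** [idm A] is a retract of the trivial fibration in any factorization of
    [idm A]. *)
Lemma weq_id (A : C) : weq M (idm A).
Proof.
have [E [i [p [e _ _ wp]]]] := fact_cof_tfib M (idm A).
apply: weq_retract wp; exists i, p, (idm A), (idm A).
by split; rewrite -?e ?comp_idl ?comp_idr.
Qed.

Lemma weq_iso (A B : C) (f : Hom A B) (g : Hom B A) :
  g \oc f = idm A -> f \oc g = idm B -> weq M f.
Proof.
move=> gf fg; apply: weq_retract (weq_id A).
by exists (idm A), (idm A), g, f; split; rewrite ?comp_idl ?comp_idr ?gf ?fg.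
Qed.

(** The retract argument: a map lifting against the second factor of its own
    factorization is a retract of the first. *)
Lemma tcof_of_lifts (A B : C) (i : Hom A B) :
  (forall (X Y : C) (p : Hom X Y), fib M p -> lifts i p) ->
  cof M i /\ weq M i.
Proof.
move=> li; have [E [j [p [e cj wj fp]]]] := fact_tcof_fib M i.
have [|s [si ps]] := li _ _ p fp j (idm B); first by rewrite comp_idl -e.
have ret : retract_of i j.
  by exists (idm A), (idm A), s, p; split; rewrite ?comp_idl ?comp_idr.
by split; [apply: cof_retract cj | apply: weq_retract wj].
Qed.

Lemma tfib_of_lifts (X Y : C) (p : Hom X Y) :
  (forall (A B : C) (i : Hom A B), cof M i -> lifts i p) ->
  fib M p /\ weq M p.
Proof.
move=> lp; have [E [i [q [e ci fq wq]]]] := fact_cof_tfib M p.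
have [|r [ri pr]] := lp _ _ i ci (idm X) q; first by rewrite comp_idr -e.
have ret : retract_of p q.
  by exists i, r, (idm Y), (idm Y); split; rewrite ?comp_idl ?comp_idr.
by split; [apply: fib_retract fq | apply: weq_retract wq].
Qed.

Lemma weakly_trivial_weq (W T : C) (f : Hom W T) :
  (forall I : C, initial I -> terminal I) ->
  weakly_trivial M W -> terminal T -> weq M f.
Proof.
move=> init_term [Z [g [initZ wg]]] termT.
have [h _] := init_term Z initZ T.
apply: weq_cancel_r wg _; apply: (@weq_iso _ _ _ h); apply: terminal_uniq => //.
exact: init_term.
Qed.

End ModelCategory.

Section AdjunctionLifting.
Variables (C D : category) (F : functor C D) (G : functor D C).
Variable a : adjunction F G.

Lemma adj_compl (A : C) (B B' : D) (g : Hom B B') (f : Hom (F A) B) :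
  adj a (g \oc f) = fmap G g \oc adj a f.
Proof.
by have := adj_nat a (idm A) g f; rewrite fmap_id !comp_idr.
Qed.

Lemma adj_compr (A A' : C) (B : D) (h : Hom A' A) (f : Hom (F A) B) :
  adj a (f \oc fmap F h) = adj a f \oc h.
Proof.
by have := adj_nat a h (idm B) f; rewrite fmap_id !comp_idl.
Qed.

Lemma adj_lifts (A B : C) (X Y : D) (i : Hom A B) (p : Hom X Y) :
  lifts (fmap F i) p <-> lifts i (fmap G p).
Proof.
have inj Z T := bij_inj (adj_bij a Z T).
split=> li u v sq.
  have [[u' _ uK] [v' _ vK]] := (adj_bij a A X, adj_bij a B Y).
  have [|w [wi pw]] := li (u' u) (v' v).
    by apply: inj; rewrite adj_compl adj_compr uK vK.
  by exists (adj a w); rewrite -adj_compr -adj_compl wi pw.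
have [|w [wi pw]] := li (adj a u) (adj a v).
  by rewrite -adj_compl -adj_compr sq.
have [w' _ wK] := adj_bij a B X.
by exists (w' w); split; apply: inj; [rewrite adj_compr wK | rewrite adj_compl wK].
Qed.

End AdjunctionLifting.

(** * Monomorphisms, epimorphisms, kernels and cokernels *)

(** Used to transfer explicit descriptions of one cokernel, in which elements
    can be computed, to an arbitrary one. *)
Lemma is_cokernel_unique (C : category) (A B : C) (f : Hom A B)
    (Q Q' : C) (q : Hom B Q) (q' : Hom B Q') :
  is_cokernel f q -> is_cokernel f q' ->
  exists (v : Hom Q Q') (w : Hom Q' Q),
    [/\ v \oc q = q', w \oc q' = q & w \oc v = idm Q].
Proof.
move=> [qf qU] [q'f q'U].
have [v [vq _]] := qU _ q' q'f; have [w [wq' _]] := q'U _ q qf.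
exists v, w; split=> //; have [e [_ eU]] := qU _ q qf.
by rewrite -(eU (w \oc v)) ?(eU (idm Q)) ?comp_idl // -comp_assoc vq.
Qed.

Section ModuleCategory.
Variable R : pzRingType.
Implicit Types A B C K : lmodType R.

Lemma LMod_zero_object : @zero_object (LMod R) ('rV[R]_0 : lmodType R).
Proof.
split=> X; exists (\0 : {linear _ -> _}); split=> // g _; apply: linear_ext => x.
  by rewrite (zero_module_rV0 x) !linear0.
by rewrite [RHS]zero_module_rV0.
Qed.

Lemma LMod_zero_mor A B (f : {linear A -> B}) :
  @zero_mor (LMod R) A B f <-> forall x, f x = 0.
Proof.
split=> [[Z [p [q [[_ termZ] ->]]]] x /=|f0].
  have [z [_ zU]] := termZ Z.
  have -> : p x = 0.
    exact: (congr1 (fun g : {linear Z -> Z} => g (p x))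
                   (etrans (esym (zU idfun Logic.I)) (zU \0 Logic.I))).
  exact: linear0.
exists ('rV[R]_0 : lmodType R), (\0 : {linear _ -> _}), (\0 : {linear _ -> _}).
split; first exact: LMod_zero_object.
by apply: linear_ext => x; rewrite f0.
Qed.

Lemma LMod_initial_zero A : @initial (LMod R) A -> zero_module A.
Proof.
move=> initA x; have [z [_ zU]] := initA A.
exact: (congr1 (fun g : {linear A -> A} => g x)
               (etrans (esym (zU idfun Logic.I)) (zU \0 Logic.I))).
Qed.

Lemma LMod_initial_terminal A : @initial (LMod R) A -> @terminal (LMod R) A.
Proof.
move=> /LMod_initial_zero A0 X; exists (\0 : {linear _ -> _}); split=> // g _.
by apply: linear_ext => x; rewrite [RHS]A0.
Qed.

Lemma LMod_mono A B (f : {linear A -> B}) : @mono (LMod R) A B f <-> injective f.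
Proof.
split=> [f_mono|f_inj X u v fuv].
  have e : ker_incl f = \0.
    apply: f_mono; apply: linear_ext => x /=; rewrite linear0.
    by apply/(ker_exact f); exists x.
  move=> x y fxy; apply/eqP; rewrite -subr_eq0; apply/eqP.
  have /(ker_exact f)[z <-] : f (x - y) = 0 by rewrite linearB fxy subrr.
  by rewrite e.
apply: linear_ext => x; apply: f_inj.
exact: (congr1 (fun g : {linear X -> B} => g x) fuv).
Qed.

Lemma LMod_epi A B (f : {linear A -> B}) :
  @epi (LMod R) A B f <-> forall b, exists a, f a = b.
Proof.
split=> [f_epi b|f_surj X u v uvf].
  have e : coker_map f = \0.
    by apply: f_epi; apply: linear_ext => x /=; rewrite coker_pi0.
  by apply/(coker_exact f); rewrite e.
apply: linear_ext => b; have [a <-] := f_surj b.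
exact: (congr1 (fun g : {linear A -> X} => g a) uvf).
Qed.

Lemma LMod_kernel A B (f : {linear A -> B}) :
  @is_kernel (LMod R) A B f (ker f) (ker_incl f).
Proof.
split=> [|X u /LMod_zero_mor fu].
  by apply/LMod_zero_mor => x; apply/(ker_exact f); exists x.
have [||v kv] := @factor_inj R _ _ _ (ker_incl f) u; first exact: ker_incl_inj.
  by move=> x; apply/(ker_exact f)/fu.
exists v; split; first exact: linear_ext.
move=> w kw; apply: linear_ext => x; apply: (@ker_incl_inj _ _ _ f); rewrite kv.
exact: (congr1 (fun g : {linear X -> A} => g x) (esym kw)).
Qed.

Lemma LMod_cokernel A B C (f : {linear A -> B}) (q : {linear B -> C}) :
  @is_cokernel (LMod R) A B f C q <->
  (forall c, exists b, q b = c) /\ exact_at f q.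
Proof.
have surj_exact C' (q' : {linear B -> C'}) : (forall c, exists b, q' b = c) ->
    exact_at f q' -> @is_cokernel (LMod R) A B f C' q'.
  move=> q_surj fq; split=> [|X u /LMod_zero_mor uf].
    by apply/LMod_zero_mor => a; apply/fq; exists a.
  have [|v vq] := @factor_surj R _ _ _ q' u q_surj.
    by move=> b /fq[a <-]; apply: uf.
  exists v; split; first exact: linear_ext.
  move=> w wq; apply: linear_ext => c; have [b <-] := q_surj c; rewrite vq.
  exact: (congr1 (fun g : {linear B -> X} => g b) (esym wq)).
split=> [qC|[]]; last exact: surj_exact.
have pC : @is_cokernel (LMod R) A B f _ (coker_map f).
  exact: (surj_exact _ _ (coker_surj f) (coker_exact f)).
have [v [w [vq wp wv]]] := is_cokernel_unique qC pC.
have vqE b : v (q b) = coker_map f b by rewrite -vq.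
have wpE b : w (coker_map f b) = q b by rewrite -wp.
split=> [c|b].
  have [b pb] := coker_surj f (v c); exists b; rewrite -wpE pb.
  exact: (congr1 (fun g : {linear C -> C} => g c) wv).
split=> [qb|[a <-]]; first by apply/coker_exact; rewrite -vqE qb linear0.
by rewrite -wpE (_ : coker_map f _ = 0) ?linear0 //; apply/coker_exact; exists a.
Qed.

End ModuleCategory.

Section ComplexCategory.
Variable R : pzRingType.
Implicit Types A B C K X Y : complex R.

Lemma chain_zero_subproof A B i j (x : A i) :
  (\0 : {linear A j -> B j}) (diff A i j x) =
  diff B i j ((\0 : {linear A i -> B i}) x).
Proof. by rewrite /= linear0. Qed.

Definition chain_zero A B : chain_map A B :=
  ChainMap (@chain_zero_subproof A B).

Lemma chain_map_congr A B (f g : chain_map A B) i x : f = g -> f i x = g i x.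
Proof. by move=> ->. Qed.

Section PullbackComplex.
Variables (A B C : complex R) (f : chain_map A C) (g : chain_map B C).

Lemma pb_diff_exists i j :
  exists d : {linear pb (f i) (g i) -> pb (f j) (g j)}, forall v,
    pb_fst (f j) (g j) (d v) = diff A i j (pb_fst (f i) (g i) v) /\
    pb_snd (f j) (g j) (d v) = diff B i j (pb_snd (f i) (g i) v).
Proof.
apply: (pb_lift (a := diff A i j \o pb_fst (f i) (g i))
                (b := diff B i j \o pb_snd (f i) (g i))) => v /=.
by rewrite !cmap_diff; congr (diff _ _ _ _); apply: pb_square.
Qed.

Definition pb_diff i j := projT1 (cid (pb_diff_exists i j)).

Lemma pb_diff_fst i j v :
  pb_fst (f j) (g j) (pb_diff i j v) = diff A i j (pb_fst (f i) (g i) v).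
Proof. exact: (projT2 (cid (pb_diff_exists i j)) v).1. Qed.

Lemma pb_diff_snd i j v :
  pb_snd (f j) (g j) (pb_diff i j v) = diff B i j (pb_snd (f i) (g i) v).
Proof. exact: (projT2 (cid (pb_diff_exists i j)) v).2. Qed.

Definition pb_cx : complex R.
Proof.
apply: (@Complex R (fun i => pb (f i) (g i)) pb_diff) => [i j v ij|i j k v].
  by apply: pb_inj; rewrite ?pb_diff_fst ?pb_diff_snd linear0 diff_shape.
by apply: pb_inj; rewrite ?pb_diff_fst ?pb_diff_snd linear0 diff_diff.
Defined.

Definition pb_cx_fst : chain_map pb_cx A :=
  @ChainMap R pb_cx A (fun i => pb_fst (f i) (g i)) pb_diff_fst.

Definition pb_cx_snd : chain_map pb_cx B :=
  @ChainMap R pb_cx B (fun i => pb_snd (f i) (g i)) pb_diff_snd.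

End PullbackComplex.

Definition zero_cx : complex R := stalk ('rV[R]_0 : lmodType R).

Lemma zero_cx0 i : zero_module (zero_cx i).
Proof. by case: i => [[|i]|i]; apply: zero_module_rV0. Qed.

Lemma Ch_zero_object : @zero_object (Ch R) zero_cx.
Proof.
split=> X; exists (chain_zero _ _); split=> // g _; apply: chain_map_ext => i x.
  by rewrite (zero_cx0 x) !linear0.
by rewrite [RHS]zero_cx0.
Qed.

Lemma Ch_zero_mor A B (f : chain_map A B) :
  @zero_mor (Ch R) A B f <-> forall i x, f i x = 0.
Proof.
split=> [[Z [p [q [[_ termZ] ->]]]] i x /=|f0].
  have [z [_ zU]] := termZ Z.
  have -> : p i x = 0.
    have e : chain_id Z = chain_zero Z Z.
      exact: etrans (esym (zU (chain_id Z) Logic.I)) (zU (chain_zero Z Z) Logic.I).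
    exact: (chain_map_congr (p i x) e).
  exact: linear0.
exists zero_cx, (chain_zero _ _), (chain_zero _ _).
by split; [exact: Ch_zero_object | apply: chain_map_ext => i x; rewrite f0].
Qed.

(** The kernel is the pullback along the zero complex. *)
Lemma complex_kernel A B (f : chain_map A B) :
  exists (K : complex R) (k : chain_map K A),
    forall i, injective (k i) /\ exact_at (k i) (f i).
Proof.
exists (pb_cx f (chain_zero zero_cx B)), (pb_cx_fst f (chain_zero zero_cx B)).
move=> i; split=> [x y xy|x].
  by apply: pb_inj => //; rewrite [LHS]zero_cx0 [RHS]zero_cx0.
split=> [fx|[y <-]]; last exact: pb_square.
have [v vx _] := @pb_mk R _ _ _ (f i) (\0 : {linear zero_cx i -> B i}) x 0 fx.
by exists v.
Qed.

Lemma complex_cokernel A B (f : chain_map A B) :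
  exists (Q : complex R) (q : chain_map B Q),
    forall i, (forall c, exists b, q i b = c) /\ exact_at (f i) (q i).
Proof.
have h i j u : (coker_map (f j) \o diff B i j : {linear _ -> _}) (f i u) = 0.
  by rewrite /= -cmap_diff; apply: coker_pi0.
pose d i j := coker_lift (h i j).
have dE i j b : d i j (coker_map (f i) b) = coker_map (f j) (diff B i j b).
  exact: coker_liftE.
have d_shape i j x : j != i + 1 -> d i j x = 0.
  by have [b <-] := coker_surj _ x => ij; rewrite dE diff_shape ?linear0.
have d_d i j k x : d j k (d i j x) = 0.
  by have [b <-] := coker_surj _ x; rewrite !dE diff_diff linear0.
exists (Complex d_shape d_d).
exists (@ChainMap R B (Complex d_shape d_d) (fun i => coker_map (f i))
         (fun i j b => esym (dE i j b))).
by move=> i; split; [exact: coker_surj | exact: coker_exact].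
Qed.

Lemma Ch_mono A B (f : chain_map A B) :
  @mono (Ch R) A B f <-> forall i, injective (f i).
Proof.
split=> [f_mono i x y fxy|f_inj X u v fuv]; last first.
  apply: chain_map_ext => i x; apply: (f_inj i).
  exact: (@chain_map_congr X B (chain_comp f u) (chain_comp f v)).
have [K [k kE]] := complex_kernel f.
have e : k = chain_zero K A.
  apply: f_mono; apply: chain_map_ext => j z /=; rewrite linear0.
  by apply/(kE j).2; exists z.
apply/eqP; rewrite -subr_eq0; apply/eqP.
have /(kE i).2[z <-] : f i (x - y) = 0 by rewrite linearB fxy subrr.
by rewrite e.
Qed.

Lemma Ch_epi A B (f : chain_map A B) :
  (forall i b, exists a, f i a = b) -> @epi (Ch R) A B f.
Proof.
move=> f_surj X u v uvf; apply: chain_map_ext => i b; have [a <-] := f_surj i b.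
exact: (@chain_map_congr A X (chain_comp u f) (chain_comp v f)).
Qed.

Lemma Ch_kernel A B (f : chain_map A B) :
  exists (K : Ch R) (k : @Hom (Ch R) K A), @is_kernel (Ch R) A B f K k.
Proof.
have [K [k kE]] := complex_kernel f; exists K, k.
split=> [|X u /Ch_zero_mor fu].
  by apply/Ch_zero_mor => i x; apply/(kE i).2; exists x.
have /family_choice[v kv] i : exists v : {linear X i -> K i}, forall x, k i (v x) = u i x.
  by apply: factor_inj (kE i).1 _ => x; apply/(kE i).2/fu.
have vd i j x : v j (diff X i j x) = diff K i j (v i x).
  by apply: (kE _).1; rewrite kv !cmap_diff kv.
exists (ChainMap vd); split; first by apply: chain_map_ext => i x; apply: kv.
move=> w kw; apply: chain_map_ext => i x; apply: (kE i).1; rewrite [LHS]kv.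
exact: (@chain_map_congr X A (u : chain_map X A) (chain_comp k w)).
Qed.

Lemma Ch_cokernel A B C (f : chain_map A B) (q : chain_map B C) :
  @is_cokernel (Ch R) A B f C q <->
  forall i, (forall c, exists b, q i b = c) /\ exact_at (f i) (q i).
Proof.
have surj_exact C' (q' : chain_map B C') :
    (forall i, (forall c, exists b, q' i b = c) /\ exact_at (f i) (q' i)) ->
    @is_cokernel (Ch R) A B f C' q'.
  move=> qE; split=> [|X u /Ch_zero_mor uf].
    by apply/Ch_zero_mor => i a; apply/(qE i).2; exists a.
  have /family_choice[v vq] i :
      exists v : {linear C' i -> X i}, forall b, v (q' i b) = u i b.
    by apply: factor_surj (qE i).1 _ => b /(qE i).2[a <-]; apply: uf.
  have vd i j c : v j (diff C' i j c) = diff X i j (v i c).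
    by have [b <-] := (qE i).1 c; rewrite -cmap_diff !vq cmap_diff.
  exists (ChainMap vd); split; first by apply: chain_map_ext => i x; apply: vq.
  move=> w wq; apply: chain_map_ext => i c; have [b <-] := (qE i).1 c.
  rewrite [LHS]vq.
  exact: (@chain_map_congr B X (u : chain_map B X) (chain_comp w q')).
split=> [qC|]; last exact: surj_exact.
have [Q [p pE]] := complex_cokernel f.
have [v [w [vq wp wv]]] := is_cokernel_unique qC (surj_exact _ _ pE).
have vqE i b : v i (q i b) = p i b by rewrite -vq.
have wpE i b : w i (p i b) = q i b by rewrite -wp.
move=> i; split=> [c|b].
  have [b pb] := (pE i).1 (v i c); exists b; rewrite -wpE pb.
  exact: (@chain_map_congr C C (chain_comp w v) (chain_id C)).
split=> [qb|[a <-]]; first by apply/(pE i).2; rewrite -vqE qb linear0.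
by rewrite -wpE (_ : p i _ = 0) ?linear0 //; apply/(pE i).2; exists a.
Qed.

End ComplexCategory.

(** * Acyclic complexes of projectives and Gorenstein projective modules *)

Section Syzygies.
Variable R : pzRingType.
Implicit Types (X C D : complex R) (G : lmodType R).

Lemma acyclic_exact X i j k : acyclic X -> j = i + 1 -> k = j + 1 ->
  exact_at (diff X i j) (diff X j k).
Proof. by move=> acX -> ->; have := acX (i + 1); rewrite addrK. Qed.

Definition shift X (s : int) : complex R.
Proof.
apply: (@Complex R (fun i => X (i + s)) (fun i j => diff X (i + s) (j + s))).
  by move=> i j x ij; rewrite diff_shape // addrAC (inj_eq (addIr s)).
by move=> i j k x; apply: diff_diff.
Defined.

Lemma acyclic_projective_shift X s :
  acyclic_projective X -> acyclic_projective (shift X s).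
Proof.
move=> [acX projX]; split=> i; last exact: projX.
by apply: (@acyclic_exact X) => //; rewrite [RHS]addrAC ?subrK.
Qed.

(** By acyclicity [C j / C i] embeds in degree [j + 1] as the cycles, so it is
    the 0-th syzygy of [C] shifted by [j + 1].  The differential from [j] to
    [0 + (j + 1)] avoids a cast between [j + 1] and [0 + (j + 1)]. *)
Lemma coker_diff_gorenstein_projective C i j :
  acyclic_projective C -> j = i + 1 -> gorenstein_projective (coker (diff C i j)).
Proof.
move=> acpC ij; have exC := acyclic_exact acpC.1.
exists (shift C (j + 1)); first exact: acyclic_projective_shift.
have [||k kE] := @factor_surj R _ _ _ (coker_map (diff C i j)) (diff C j (0 + (j + 1))).
- exact: coker_surj.
- by move=> x /coker_exact[y <-]; rewrite diff_diff.
exists k; split=> [x y|x].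
  have [a <-] := coker_surj _ x; have [b <-] := coker_surj _ y.
  rewrite !kE => /eqP; rewrite -subr_eq0 -linearB => /eqP.
  move=> /(exC i j (0 + (j + 1)) ij); rewrite add0r => /(_ erefl) ab.
  apply/eqP; rewrite -subr_eq0 -linearB; exact/eqP/coker_exact.
apply: (iff_trans (exC j (0 + (j + 1)) (1 + (j + 1)) _ _ x)).
- by rewrite add0r.
- by rewrite add0r addrC.
split=> [[y <-]|[y <-]]; first by exists (coker_map _ y); rewrite kE.
by have [z <-] := coker_surj _ y; exists z; rewrite kE.
Qed.

(** Syzygies are cosyzygies: the 0-th syzygy of an acyclic complex is the 0-th
    cosyzygy of the complex shifted by one. *)
Lemma gorenstein_projective_coker G : gorenstein_projective G ->
  exists D : complex R, acyclic_projective D /\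
    exists t : {linear D 0 -> G},
      (forall x, exists y, t y = x) /\ exact_at (diff D (-1) 0) t.
Proof.
move=> [X acpX [k [k_inj kX]]]; have exX := acyclic_exact acpX.1.
exists (shift X (-1)); split; first exact: acyclic_projective_shift.
have [|t tE] := @factor_inj R _ _ _ k (diff X (0 + -1) 0) k_inj.
  by move=> x; apply/kX; rewrite diff_diff.
exists t; split=> [x|y].
  have [|y yE] := (exX (0 + -1) 0 1 erefl erefl (k x)).1.
    by apply/kX; exists x.
  by exists y; apply: k_inj; rewrite tE.
apply: iff_trans (exX (-1 + -1) (0 + -1) 0 erefl erefl y).
rewrite -tE; split=> [->|ky]; first by rewrite linear0.
by apply: k_inj; rewrite ky linear0.
Qed.

End Syzygies.

(** * Lifting against the unit *)

(** The vanishing of Ext^1(G, P) for all Gorenstein projective [G], in the form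
    in which it is used. *)
Definition extends_along_gorenstein (R : pzRingType) (P : lmodType R) :=
  forall (A B G : lmodType R) (i : {linear A -> B}) (q : {linear B -> G})
    (u : {linear A -> P}),
  injective i -> (forall c, exists b, q b = c) -> exact_at i q ->
  gorenstein_projective G ->
  exists w : {linear B -> P}, forall a, w (i a) = u a.

(** The map [u] descends to the image of [f], which is the kernel of [q], and
    extends from there because the inclusion of that kernel is a monomorphism
    with cokernel [G]. *)
Lemma extend_gorenstein_coker (R : pzRingType) (P S B G : lmodType R)
    (f : {linear S -> B}) (q : {linear B -> G}) (u : {linear S -> P}) :
  extends_along_gorenstein P ->
  (forall c, exists b, q b = c) -> exact_at f q -> gorenstein_projective G ->
  (forall s, f s = 0 -> u s = 0) ->
  exists w : {linear B -> P}, forall s, w (f s) = u s.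
Proof.
move=> extP q_surj fq GPG uf.
have [||f' f'E] := @factor_inj R _ _ _ (ker_incl q) f; first exact: ker_incl_inj.
  by move=> s; apply/(ker_exact q)/fq; exists s.
have [||u' u'E] := @factor_surj R _ _ _ f' u.
- move=> c; have /fq[s fs] : q (ker_incl q c) = 0 by apply/(ker_exact q); exists c.
  by exists s; apply: (@ker_incl_inj _ _ _ q); rewrite f'E.
- by move=> s f's; apply: uf; rewrite -f'E f's linear0.
have [||w wE] := extP _ _ _ (ker_incl q) q u' _ q_surj _ GPG.
- exact: ker_incl_inj.
- exact: ker_exact.
by exists w => s; rewrite -f'E wE u'E.
Qed.

Lemma dependent_choice (T : nat -> Type) (P : forall n, T n -> Prop)
    (Q : forall n, T n -> T n.+1 -> Prop) (x0 : T 0%N) :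
  P 0%N x0 -> (forall n x, P n x -> exists2 y, P n.+1 y & Q n x y) ->
  exists s : forall n, T n,
    [/\ s 0%N = x0, forall n, P n (s n) & forall n, Q n (s n) (s n.+1)].
Proof.
move=> P0 step.
have next n (x : {x : T n | P n x}) :
    {y : {y : T n.+1 | P n.+1 y} | Q n (sval x) (sval y)}.
  case: x => x Px; have /cid2[y Py Qxy] := step n x Px.
  by exists (exist _ y Py).
pose s := fix s n : {x : T n | P n x} :=
  if n is m.+1 then sval (next m (s m)) else exist _ x0 P0.
exists (fun n => sval (s n)); split=> // n; first exact: svalP.
exact: (svalP (next n (s n))).
Qed.

Section UnitLifting.
Variables (R : pzRingType) (A B C X : complex R).
Variables (i : chain_map A B) (q : chain_map B C) (u : chain_map A X).
Hypothesis i_inj : forall k, injective (i k).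
Hypothesis iq : forall k, (forall c, exists b, q k b = c) /\ exact_at (i k) (q k).
Hypothesis acpC : acyclic_projective C.
Hypothesis acpX : acyclic_projective X.

(** The state of the degreewise construction.  The second clause says that
    [w] maps boundaries to boundaries.  It lets the construction descend;
    since it makes [diff X k l \o w] vanish on boundaries, it also lets the
    construction ascend. *)
Definition partial_lift (k : int) (w : {linear B k -> X k}) : Prop :=
  (forall a, w (i k a) = u k a) /\
  forall j b, exists x, diff X j k x = w (diff B j k b).

(** Lift [w \o diff B j k] along [diff X j k]; the projective cokernel is [C j].
    Acyclicity of [X] reestablishes the second clause. *)
Lemma partial_lift_down (j k : int) (w : {linear B k -> X k}) :
  k = j + 1 -> partial_lift w ->
  exists2 w' : {linear B j -> X j},
    partial_lift w' & forall b, diff X j k (w' b) = w (diff B j k b).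
Proof.
move=> kj [wi wd].
have [|w' w'i w'd] := @lift_projective_coker R _ _ _ _ _ (i j) (q j)
    (diff X j k) (u j) (w \o diff B j k)
    (@i_inj j) (iq j).1 (iq j).2 (acpC.2 j) (wd j).
  by move=> a /=; rewrite -(cmap_diff i) wi cmap_diff.
exists w' => //; split=> // m b.
have [jm|jm] := eqVneq j (m + 1); last first.
  by exists 0; rewrite !diff_shape // !linear0.
apply/(acyclic_exact acpX.1 jm kj).
by rewrite w'd /= diff_diff linear0.
Qed.

(** The values of [w'] are prescribed on the image of [A l + B k] in [B l], whose
    cokernel is the cosyzygy [C l / C k]; they extend to [B l] because the
    cosyzygy is Gorenstein projective. *)
Lemma partial_lift_up (k l : int) (w : {linear B k -> X k}) :
  (forall k, extends_along_gorenstein (X k)) ->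
  l = k + 1 -> partial_lift w ->
  exists2 w' : {linear B l -> X l},
    partial_lift w' & forall b, w' (diff B k l b) = diff X k l (w b).
Proof.
move=> extX lk [wi wd].
pose f : {linear (A l * B k)%type -> B l} := (i l \o fst) \+ (diff B k l \o snd).
pose g : {linear (A l * B k)%type -> X l} :=
  (u l \o fst) \+ (diff X k l \o w \o snd).
pose p : {linear B l -> coker (diff C k l)} := coker_map (diff C k l) \o q l.
have p_surj c : exists b, p b = c.
  have [z <-] := coker_surj _ c; have [b <-] := (iq l).1 z.
  by exists b.
have fp : exact_at f p.
  move=> b; split=> [/coker_exact[c dc]|[[a b'] <-]].
    have [b' qb'] := (iq k).1 c.
    have /(iq l).2[a ia] : q l (b - diff B k l b') = 0.
      by rewrite linearB cmap_diff qb' dc subrr.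
    by exists (a, b'); rewrite /= ia subrK.
  apply/coker_exact; exists (q k b'); rewrite /= linearD cmap_diff.
  by have /(iq l).2 -> : exists a', i l a' = i l a; [exists a | rewrite add0r].
(* If [i a + diff b = 0], then [q b] is a cycle, hence a boundary of [C], so [b]
   is a boundary plus an element [i a'], and [a = - diff a']. *)
have gf s : f s = 0 -> g s = 0.
  case: s => a b /= /eqP; rewrite addr_eq0 => /eqP iad.
  have [c dc] : exists c, diff C (k - 1) k c = q k b.
    apply/(acyclic_exact acpC.1 (esym (subrK 1 k)) lk).
    rewrite -cmap_diff -[diff B k l b]opprK -iad linearN.
    have /(iq l).2 -> : exists a', i l a' = i l a by exists a.
    by rewrite oppr0.
  have [b' qb'] := (iq (k - 1)).1 c.
  have /(iq k).2[a' ia'] : q k (b - diff B (k - 1) k b') = 0.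
    by rewrite linearB cmap_diff qb' dc subrr.
  have [x dx] := wd (k - 1) b'.
  have eb : b = diff B (k - 1) k b' + i k a' by rewrite ia' addrC subrK.
  have -> : a = - diff A k l a'.
    by apply: (@i_inj l); rewrite iad linearN cmap_diff eb linearD diff_diff add0r.
  by rewrite eb !linearD linearN -dx diff_diff wi cmap_diff add0r addNr.
have [w' w'E] := extend_gorenstein_coker (extX l) p_surj fp
  (coker_diff_gorenstein_projective acpC lk) gf.
have w'd b : w' (diff B k l b) = diff X k l (w b).
  by have := w'E (0, b); rewrite /= !linear0 !add0r.
exists w' => //; split=> [a|j b].
  by have := w'E (a, 0); rewrite /= !linear0 !addr0.
have [lj|lj] := eqVneq l (j + 1); last first.
  by exists 0; rewrite !diff_shape // !linear0.
have {lj}e : j = k by apply: (addIr 1); rewrite -lj.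
by subst j; exists (w b).
Qed.

(** Degree 0 lifts [v] along [X 0 -> Q0 X], which makes [w0] map boundaries to
    boundaries because [v] kills them; all other degrees follow by descending
    and ascending from there.  In nonzero degrees compatibility with [v] is
    vacuous. *)
Lemma unit_lift (v : chain_map B (stalk (Q0_ob X))) :
  (forall k, extends_along_gorenstein (X k)) ->
  (forall k a, transpose (idfun : {linear Q0_ob X -> Q0_ob X}) k (u k a) = v k (i k a)) ->
  exists w : chain_map B X,
    (forall k a, w k (i k a) = u k a) /\
    forall k b, transpose (idfun : {linear Q0_ob X -> Q0_ob X}) k (w k b) = v k b.
Proof.
move=> extX sq.
have [|w0 w0i w0v] := @lift_projective_coker R _ _ _ _ _ (i 0) (q 0)
    (Q0_pi X) (u 0) (v 0) (@i_inj 0) (iq 0).1 (iq 0).2 (acpC.2 0) _ (sq 0).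
  by move=> b; apply: coker_surj.
have pl0 : partial_lift w0.
  split=> // j b; have [j1|j1] := eqVneq 0 (j + 1); last first.
    by exists 0; rewrite !diff_shape // !linear0.
  have {j1}e : j = -1 by apply: (addIr 1); rewrite -j1.
  subst j; apply/(coker_exact (diff X (-1) 0)).
  by apply: etrans (w0v _) _; rewrite cmap_diff.
have posS n : n.+1%:Z = n%:Z + 1 by rewrite -addn1 PoszD.
have negS n : Negz n = Negz n.+1 + 1.
  by rewrite !NegzE [in RHS]posS opprD subrK.
have [wp [wp0 wp_lift wp_d]] := @dependent_choice
  (fun n => {linear B (Posz n) -> X (Posz n)}) (fun n w => partial_lift w)
  (fun n w w' => forall b, w' (diff B n n.+1 b) = diff X n n.+1 (w b)) w0 pl0
  (fun n w => @partial_lift_up n n.+1 w extX (posS n)).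
have [wm0 wm0_lift wm0_d] := @partial_lift_down (-1) 0 w0 erefl pl0.
have [wm [wm_eq wm_lift wm_d]] := @dependent_choice
  (fun n => {linear B (Negz n) -> X (Negz n)}) (fun n w => partial_lift w)
  (fun n w w' => forall b, diff X (Negz n.+1) (Negz n) (w' b) =
                           w (diff B (Negz n.+1) (Negz n) b)) wm0 wm0_lift
  (fun n w => @partial_lift_down (Negz n.+1) (Negz n) w (negS n)).
pose w k : {linear B k -> X k} :=
  match k with Posz n => wp n | Negz n => wm n end.
have w_lift k : partial_lift (w k) by case: k => n; [exact: wp_lift | exact: wm_lift].
have w_d k l b : w l (diff B k l b) = diff X k l (w k b).
  have [|lk] := eqVneq l (k + 1); last by rewrite !diff_shape ?linear0.
  case: k b => [n|[|n]] b.
  - by rewrite -posS => e; subst l; apply: wp_d.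
  - by move=> e; subst l; rewrite /= wm_eq wp0; apply/esym/(wm0_d b).
  - by rewrite -negS => e; subst l; apply/esym/wm_d.
exists (ChainMap w_d); split=> [k a|k b]; first exact: (w_lift k).1.
case: k b => [[|n]|n] b.
- by have := w0v b; rewrite -wp0.
- by rewrite [LHS]zero_module_rV0 [RHS]zero_module_rV0.
- by rewrite [LHS]zero_module_rV0 [RHS]zero_module_rV0.
Qed.

End UnitLifting.

(** * The two model structures *)

Section GorensteinProjectiveModel.
Variables (R : pzRingType) (M : model_structure (LMod R)).
Hypothesis hM : Gproj_model M.
Implicit Types A B G P X Y : lmodType R.

Lemma Gproj_cof A B (i : {linear A -> B}) :
  @cof (LMod R) M A B i <->
  injective i /\ exists G (q : {linear B -> G}),
    [/\ forall c, exists b, q b = c, exact_at i q & gorenstein_projective G].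
Proof.
have [[cofE _] _ cofibE _] := hM.
split=> [/cofE[/LMod_mono i_inj [G [q [/LMod_cokernel[q_surj iq] /cofibE GPG]]]]|].
  by split=> //; exists G, q.
move=> [/LMod_mono i_mono [G [q [q_surj iq GPG]]]]; apply/cofE; split=> //.
by exists G, q; split; [exact/LMod_cokernel | exact/cofibE].
Qed.

Lemma Gproj_fib A B (p : {linear A -> B}) :
  @fib (LMod R) M A B p <-> forall b, exists a, p a = b.
Proof.
have [[_ fibE] allfib _ _] := hM.
split=> [/fibE[/LMod_epi] //|/LMod_epi p_epi]; apply/fibE; split=> //.
by exists (ker p : lmodType R), (ker_incl p); split; [exact: LMod_kernel | exact: allfib].
Qed.

(** [P] has finite projective dimension, so [P -> 0] is a trivial fibration;
    lifting the cofibration [i] against it is the extension problem. *)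
Lemma Gproj_extend P : projective_module P -> extends_along_gorenstein P.
Proof.
move=> projP A B G i q u i_inj q_surj iq GPG.
have [_ allfib _ wtE] := hM.
have [T [f [termT fibf]]] := allfib P.
have wf : weq M f.
  apply: weakly_trivial_weq termT; first exact: LMod_initial_terminal.
  exact/wtE/finite_projdim_projective.
have ci : @cof (LMod R) M A B i by apply/Gproj_cof; split=> //; exists G, q.
have [v _] := termT B.
have sq : f \oc (u : @Hom (LMod R) A P) = v \oc (i : @Hom (LMod R) A B).
  exact: terminal_uniq.
have [w [wi _]] := lift_cof_tfib ci fibf wf sq.
by exists w => a; rewrite -wi.
Qed.

End GorensteinProjectiveModel.

Section SingularModel.
Variables (R : pzRingType) (M : model_structure (Ch R)).
Hypothesis hM : ctr_sing_model M.
Implicit Types A B C X Y : complex R.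

Lemma ctr_cof A B (i : chain_map A B) :
  @cof (Ch R) M A B i <->
  (forall k, injective (i k)) /\ exists C (q : chain_map B C),
    (forall k, (forall c, exists b, q k b = c) /\ exact_at (i k) (q k)) /\
    acyclic_projective C.
Proof.
have [[cofE _] _ cofibE] := hM.
split=> [/cofE[/Ch_mono i_inj [C [q [/Ch_cokernel qC /cofibE acpC]]]]|].
  by split=> //; exists C, q.
move=> [/Ch_mono i_mono [C [q [qC acpC]]]]; apply/cofE; split=> //.
by exists C, q; split; [exact/Ch_cokernel | exact/cofibE].
Qed.

Lemma ctr_fib A B (p : chain_map A B) :
  (forall k b, exists a, p k a = b) -> @fib (Ch R) M A B p.
Proof.
have [[_ fibE] allfib _] := hM => /Ch_epi p_epi; apply/fibE; split=> //.
by have [K [k kK]] := Ch_kernel p; exists K, k; split.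
Qed.

End SingularModel.

(** * The Quillen equivalence *)

Section Equivalence.
Variable R : pzRingType.
Variables (MC : model_structure (Ch R)) (MD : model_structure (LMod R)).
Hypotheses (hC : ctr_sing_model MC) (hD : Gproj_model MD).

Lemma stalk_surj (A B : lmodType R) (p : {linear A -> B}) :
  (forall b, exists a, p a = b) ->
  forall k b, exists a, stalk_map p k a = b.
Proof. by move=> p_surj [[|n]|n] b; [exact: p_surj | exists b | exists b]. Qed.

Lemma iota0_fib (A B : LMod R) (p : Hom A B) :
  fib MD p -> fib MC (fmap (iota0 R) p).
Proof. by move/(Gproj_fib hD)/stalk_surj/(ctr_fib hC). Qed.

(** With [C] the cokernel, exactness of [C] at degree -1 makes [Q0 A -> Q0 B]
    injective: if [i x] is the boundary of [c], then [q c] is a cycle, so it is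
    a boundary, and [c] may be corrected by a boundary to lie in [A]. *)
Lemma Q0_cof (A B : Ch R) (i : Hom A B) :
  cof MC i -> cof MD (fmap (Q0 R) i).
Proof.
move=> /(ctr_cof hC)[i_inj [C [q [iq acpC]]]].
apply/(Gproj_cof hD); split=> [x y|].
  have [a <-] := coker_surj _ x; have [b <-] := coker_surj _ y => /eqP.
  rewrite -subr_eq0 -linearB -linearB => /eqP.
  move=> /(etrans (esym (Q0_mapE i (a - b)))) /(coker_exact (diff B (-1) 0))[c dc].
  have [z dz] : exists z, diff C (-1 - 1) (-1) z = q (-1) c.
    apply/(@acyclic_exact R C (-1 - 1) (-1) 0 acpC.1 erefl erefl); rewrite -cmap_diff dc.
    by apply/(iq 0).2; exists (a - b).
  have [b' qb'] := (iq (-1 - 1)).1 z.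
  have /(iq (-1)).2[a' ia'] : q (-1) (c - diff B (-1 - 1) (-1) b') = 0.
    by rewrite linearB cmap_diff qb' dz subrr.
  apply/eqP; rewrite -subr_eq0 -linearB; apply/eqP/(coker_exact (diff A (-1) 0)).
  exists a'; apply: i_inj; rewrite cmap_diff ia' -dc.
  by rewrite linearB diff_diff subr0.
exists (Q0_ob C), (Q0_map q); split.
- move=> y; have [c <-] := coker_surj _ y; have [b <-] := (iq 0).1 c.
  by exists (Q0_pi B b); apply: Q0_mapE.
- move=> y; have [b <-] := coker_surj _ y; split.
    move=> /(etrans (esym (Q0_mapE q b))) /(coker_exact (diff C (-1) 0))[c dc].
    have [b' qb'] := (iq (-1)).1 c.
    have /(iq 0).2[a ia] : q 0 (b - diff B (-1) 0 b') = 0.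
      by rewrite linearB cmap_diff qb' dc subrr.
    exists (Q0_pi A a); apply: etrans (Q0_mapE i a) _; rewrite ia linearB.
    by rewrite [X in _ - X]coker_pi0 subr0.
  move=> [z <-]; have [a <-] := coker_surj _ z.
  apply: etrans (congr1 (Q0_map q) (Q0_mapE i a)) _.
  apply: etrans (Q0_mapE q _) _.
  have /(iq 0).2 -> : exists a', i 0 a' = i 0 a by exists a.
  exact: linear0.
- exact: coker_diff_gorenstein_projective acpC erefl.
Qed.

Lemma Q0_iota0_quillen : quillen_adjunction (Q0 R) MC MD.
Proof.
split=> [|A B i ci wi]; first exact: Q0_cof.
apply: tcof_of_lifts => X Y p fp; apply/(adj_lifts (Q0_iota0_adjunction R)).
exact: (lift_tcof_fib ci wi (iota0_fib fp)).
Qed.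

Lemma iota0_tfib (A B : LMod R) (p : Hom A B) :
  fib MD p -> weq MD p -> weq MC (fmap (iota0 R) p).
Proof.
move=> fp wp; apply: (tfib_of_lifts _).2 => X Y j cj.
apply/(adj_lifts (Q0_iota0_adjunction R)).
exact: lift_cof_tfib (Q0_cof cj) fp wp.
Qed.

(** Ken Brown's lemma.  In a factorization [f = p \oc i] the trivial
    cofibration [i] has a retraction, because its source is fibrant; the
    retraction is again a trivial fibration. *)
Lemma iota0_weq (A B : LMod R) (f : Hom A B) :
  weq MD f -> weq MC (fmap (iota0 R) f).
Proof.
move=> wf; have [E [i [p [e ci wi fp]]]] := fact_tcof_fib MD f.
have wp : weq MD p by apply: weq_cancel_r wi _; rewrite -e.
rewrite e fmap_comp; apply: weq_comp (iota0_tfib fp wp).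
have [_ allfib _ _] := hD; have [T [g [termT fg]]] := allfib A.
have [v _] := termT E.
have sq : g \oc idm A = v \oc i by apply: terminal_uniq.
have [r [ri _]] := lift_tcof_fib ci wi fg sq.
have fr : fib MD r.
  apply/(Gproj_fib hD) => a; exists (i a).
  exact: (congr1 (fun h : {linear A -> A} => h a) ri).
have wr : weq MD r.
  by apply: weq_cancel_r wi _; rewrite ri; apply: weq_id.
apply: (@weq_cancel_l _ MC _ _ _ _ (fmap (iota0 R) r)).
  exact: iota0_tfib.
by rewrite -fmap_comp ri fmap_id; apply: weq_id.
Qed.

(** Every cofibration [j] of modules is [Q0] of a cofibration [s] of complexes:
    take an acyclic complex [D] of projectives with [Q0 D] the cokernel of
    [j], and let [V] be the pullback of [D -> iota0 (Q0 D) <- iota0 Y].  The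
    cokernel of [iota0 X -> V] is [D], and the last two clauses say that
    [Q0 V = Y]. *)
Lemma stalk_cofibration (X Y : lmodType R) (j : {linear X -> Y}) :
  @cof (LMod R) MD X Y j ->
  exists (V : complex R) (s : chain_map (stalk X) V) (b : chain_map V (stalk Y)),
    [/\ @cof (Ch R) MC _ _ s,
        forall k x, b k (s k x) = stalk_map j k x,
        forall y : Y, exists v, b 0 v = y
      & exact_at (diff V (-1) 0) (b 0)].
Proof.
move=> /(Gproj_cof hD)[j_inj [G [q [q_surj jq GPG]]]].
have [D [acpD [t [t_surj Dt]]]] := gorenstein_projective_coker GPG.
have td x : t (diff D (-1) 0 x) = 0 by apply/Dt; exists x.
pose h : chain_map D (stalk G) := transpose (coker_lift td).
pose V := pb_cx (stalk_map q) h.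
pose b : chain_map V (stalk Y) := pb_cx_fst (stalk_map q) h.
pose d : chain_map V D := pb_cx_snd (stalk_map q) h.
have qj k x : stalk_map q k (stalk_map j k x) = 0.
  case: k x => [[|n]|n] x; last 2 first.
  - exact: zero_module_rV0.
  - exact: zero_module_rV0.
  - by apply/jq; exists x.
have jq_stalk k y : stalk_map q k y = 0 -> exists x, stalk_map j k x = y.
  by case: k y => [[|n]|n] y; [move/jq | exists y | exists y].
have j_stalk_inj k : injective (stalk_map j k).
  by case: k => [[|n]|n] // x y _; rewrite [LHS]zero_module_rV0 [RHS]zero_module_rV0.
have /family_choice[s0 s0E] k : exists s : {linear stalk X k -> V k},
    forall x, b k (s x) = stalk_map j k x /\ d k (s x) = 0.
  by apply: (pb_lift (b := \0)) => x; rewrite qj linear0.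
have s_diff k l x : s0 l (diff (stalk X) k l x) = diff V k l (s0 k x).
  apply: pb_inj; rewrite ?pb_diff_fst ?pb_diff_snd.
    rewrite [LHS](s0E l _).1 [in RHS](s0E k x).1; exact: cmap_diff.
  by rewrite [LHS](s0E l _).2 [in RHS](s0E k x).2 linear0.
pose s : chain_map (stalk X) V := ChainMap s_diff.
have cs : @cof (Ch R) MC _ _ s.
  apply/(ctr_cof hC); split=> [k x y sxy|].
    by apply: (j_stalk_inj k); rewrite -(s0E k x).1 -(s0E k y).1; congr (b k _).
  exists D, d; split=> // k; split=> [y|v'].
    have [z qz] := stalk_surj q_surj (h k y).
    by have [v' _ v'y] := pb_mk qz; exists v'.
  split=> [dv|[x <-]]; last exact: (s0E k x).2.
  have [|x jx] := jq_stalk k (b k v').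
    by apply: etrans (pb_square v') _; rewrite [X in h k X]dv linear0.
  exists x; apply: pb_inj; first by rewrite [LHS](s0E k x).1.
  by rewrite [LHS](s0E k x).2.
exists V, s, b; split=> // [k x|y|v].
- exact: (s0E k x).1.
- have [x tx] := t_surj (q y).
  have qh : stalk_map q 0 y = h 0 (x : D 0) by rewrite /= -tx coker_liftE.
  by have [x' x'y _] := pb_mk qh; exists x'.
split=> [bv|[z <-]]; last by rewrite cmap_diff.
have /Dt[x dx] : t (d 0 v) = 0.
  have : q (b 0 v) = t (d 0 v).
    by apply: etrans (pb_square v) _; rewrite /= coker_liftE.
  by rewrite bv linear0.
have qh : stalk_map q (-1) 0 = h (-1) x.
  by rewrite [LHS]zero_module_rV0 [RHS]zero_module_rV0.
have [z _ zx] := pb_mk qh; exists z.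
apply: pb_inj; rewrite ?pb_diff_fst ?pb_diff_snd; first exact: esym bv.
by rewrite zx dx.
Qed.

(** After factoring [f] as a trivial cofibration and an epimorphism [p], the
    map [iota0 p] is a trivial fibration; lifting it against the cofibrations
    [s] above and descending the lift along [V -> iota0 Y] solves every
    lifting problem for [p]. *)
Lemma iota0_reflects_weq (A B : LMod R) (f : Hom A B) :
  weq MC (fmap (iota0 R) f) -> weq MD f.
Proof.
move=> wf; have [E [i [p [e ci wi fp]]]] := fact_tcof_fib MD f.
have wp : weq MC (fmap (iota0 R) p).
  by apply: weq_cancel_r (iota0_weq wi) _; rewrite -fmap_comp -e.
rewrite e; apply: weq_comp wi _; apply: (tfib_of_lifts _).2 => X Y j cj u v sq.
have [V [s [b [cs bs b_surj Vb]]]] := stalk_cofibration cj.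
have sqV : fmap (iota0 R) p \oc (stalk_map u : @Hom (Ch R) (stalk X) (stalk E)) =
    (chain_comp (stalk_map v) b : @Hom (Ch R) V (stalk B)) \oc s.
  apply: chain_map_ext => k x.
  apply: etrans (congr1 (stalk_map v k) (esym (bs k x))).
  case: k x => [[|n]|n] x //.
  exact: (congr1 (fun g : {linear X -> B} => g x) sq).
have [W [Ws pW]] := lift_cof_tfib cs (iota0_fib fp) wp sqV.
have [w wE] : exists w : {linear Y -> E}, forall z, w (b 0 z) = (W : chain_map _ _) 0 z.
  apply: (@factor_surj R _ _ _ (b 0)) b_surj _ => z /Vb[z' <-].
  by rewrite cmap_diff.
exists w; split; apply: linear_ext => x.
  apply: etrans (congr1 w (esym (bs 0 x))) _; apply: etrans (wE _) _.
  exact: (@chain_map_congr _ (stalk X) (stalk E) _ _ 0 x Ws).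
have [z <-] := b_surj x.
apply: etrans (congr1 (p : {linear E -> B}) (wE z)) _.
exact: (@chain_map_congr _ V (stalk B) _ _ 0 z pW).
Qed.

Lemma unit_weq (X : Ch R) :
  cofibrant MC X -> weq MC (adj (Q0_iota0_adjunction R) (idm (Q0 R X))).
Proof.
have [_ _ cofibE] := hC; move=> /cofibE acpX.
apply: (tfib_of_lifts _).2 => A B i /(ctr_cof hC)[i_inj [C [q [iq acpC]]]] u v sq.
have [|k a|w [wi wv]] := @unit_lift R A B C X i q u i_inj iq acpC acpX v.
- by move=> k; apply: (Gproj_extend hD); apply: acpX.2.
- exact: (chain_map_congr a sq).
by exists w; split; apply: chain_map_ext => k z; [exact: wi | exact: wv].
Qed.

End Equivalence.

Theorem proposition3p1p3 (R : pzRingType) (hR : gorenstein R)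
    (Mctr : model_structure (Ch R)) (hctr : ctr_sing_model Mctr)
    (MGproj : model_structure (LMod R)) (hGproj : Gproj_model MGproj) :
  quillen_equivalence (Q0_iota0_adjunction R) Mctr MGproj.
Proof.
split=> [|X Y cX _ f]; first exact: Q0_iota0_quillen.
have unitX := unit_weq hctr hGproj cX.
rewrite -[f in adj _ f]comp_idr adj_compl; split=> [wf|wf].
  exact: weq_comp unitX (iota0_weq hctr hGproj wf).
apply: (iota0_reflects_weq hctr hGproj); exact: weq_cancel_r unitX wf.
Qed.
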